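(* Let $A$ be a dilation on $\mathbb{R}^n$, $1\le p<\infty$, $\theta>0$, $q(\cdot)\in\mathcal{P}(\mathbb{R}^n)$, and let $\alpha(\cdot)\in L^\infty(\mathbb{R}^n)$ be a real-valued function which is log-H\''older continuous at the origin and at infinity, with $0<\alpha_\infty<\infty$. The following two statements are equivalent: (i) $f\in K^{\alpha(\cdot),p)}_{q(\cdot),\theta}(A;\mathbb{R}^n)$. (ii) $f$ can be represented by $$f(x)=\sum_{k=0}^{\infty}\lambda_k a_k(x),$$ where each $a_k$ is a central $(\alpha(\cdot),q(\cdot))$-block of restricted type with support contained in $B_k$ and $$\sup_{\varepsilon>0}\Big(\varepsilon^\theta\sum_{k=0}^\infty|\lambda_k|^{p(1+\varepsilon)}\Big)^{\frac{1}{p(1+\varepsilon)}}<\infty .$$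
   Context: Dilations. A dilation is a real $n\times n$ matrix $A$ all of whose eigenvalues $\lambda$ satisfy $|\lambda|>1$; $b=|\det A|$. Fix an ellipsoid $\Delta=\{x\in\mathbb{R}^n:|Px|<1\}$ ($P$ a nondegenerate $n\times n$ matrix) with $|\Delta|=1$ and a number $r>1$ such that $\Delta\subset r\Delta\subset A\Delta$. For $k\in\mathbb{Z}$ put $B_k=A^k\Delta$ (so $|B_k|=b^k$ and $B_k\subset rB_k\subset B_{k+1}$), $C_k=B_k\setminus B_{k-1}$. Put $\tilde\chi_k=\chi_{C_k}$ for $k\ge1$ and $\tilde\chi_0=\chi_{B_0}$. Variable exponents. $\mathcal{P}(\mathbb{R}^n)$ is the set of measurable $q(\cdot):\mathbb{R}^n\to[1,\infty)$ with $q^-=\operatorname{ess\,inf} q>1$ and $q^+=\operatorname{ess\,sup}q<\infty$. The norm is $\|f\|_{L^{q(\cdot)}(\mathbb{R}^n)}=\inf\{\lambda>0:\int_{\mathbb{R}^n}(|f(x)|/\lambda)^{q(x)}dx\le1\}$. $L^{q(\cdot)}_{\rm loc}(\Omega)$ is the set of $f$ with $f\in L^{q(\cdot)}(E)$ for all compact $E\subset\Omega$. A function $g:\mathbb{R}^n\to\mathbb{R}$ is log-H\''older continuous at the origin if there is $C>0$ with $|g(x)-g(0)|\le C/\log(e+1/|x|)$ for all $x$, and log-H\''older continuous at infinity if there are $g_\infty\in\mathbb{R}$ and $C>0$ with $|g(x)-g_\infty|\le C/\log(e+|x|)$ for all $x$. $\alpha_\infty$ denotes this limit for $\alpha(\cdot)$.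 Space. $K^{\alpha(\cdot),p)}_{q(\cdot),\theta}(A;\mathbb{R}^n)$ is the set of $f\in L^{q(\cdot)}_{\rm loc}(\mathbb{R}^n)$ with $$\|f\|_{K^{\alpha(\cdot),p)}_{q(\cdot),\theta}(A;\mathbb{R}^n)}=\sup_{\varepsilon>0}\Big(\varepsilon^\theta\sum_{k=0}^\infty\|b^{k\alpha(\cdot)}f\tilde\chi_k\|_{L^{q(\cdot)}(\mathbb{R}^n)}^{p(1+\varepsilon)}\Big)^{\frac1{p(1+\varepsilon)}}<\infty.$$ Blocks. A measurable function $a$ is a central $(\alpha(\cdot),q(\cdot))$-block of restricted type with support contained in $B_l$ ($l\ge0$ an integer) if $\operatorname{supp}a\subset B_l$ and $\|a\|_{L^{q(\cdot)}(\mathbb{R}^n)}\le b^{-l\alpha_\infty}$. *)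

(* Defs.v *)
From HB Require Import structures.
From mathcomp Require Import all_boot all_order all_algebra.
From mathcomp Require Import complex.
From mathcomp Require Import all_classical all_reals all_analysis.
From mathcomp Require Import ess_sup_inf.

Set Implicit Arguments.
Unset Strict Implicit.
Unset Printing Implicit Defensive.

Import Order.TTheory GRing.Theory Num.Theory.
Import numFieldNormedType.Exports.

Local Open Scope classical_set_scope.
Local Open Scope ring_scope.

(* Lebesgue measure on R^n, the dimension being written n.+1 and points being
   column vectors.  The outer measure is the infimum of the total volume of
   countable covers by boxes ]a_0, b_0] x ... x ]a_n, b_n]; Carathéodory's
   construction then gives the sigma-algebra of all Lebesgue measurable sets
   (not only the Borel sets) and the complete Lebesgue measure on it. *)

Section lebesgue_outer.
Variables (R : realType) (n : nat).
Implicit Types (c : 'cV[R]_n.+1 * 'cV[R]_n.+1) (X : set 'cV[R]_n.+1).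

Definition box c : set 'cV[R]_n.+1 :=
  [set x | forall i, c.1 i 0 < x i 0 <= c.2 i 0].

(* The maximum gives volume 0 to boxes with c.2 i 0 < c.1 i 0 for some i,
   which are empty. *)
Definition box_volume c : R := \prod_i Num.max 0 (c.2 i 0 - c.1 i 0).

Definition box_cover X : set (nat -> 'cV[R]_n.+1 * 'cV[R]_n.+1) :=
  [set c | X `<=` \bigcup_k box (c k)].

Definition lebesgue_outer X : \bar R :=
  ereal_inf [set (\sum_(0 <= k <oo) (box_volume (c k))%:E)%E
            | c in box_cover X].

Lemma box_volume_ge0 c : 0 <= box_volume c.
Proof. by apply: prodr_ge0 => i _; rewrite le_max lexx. Qed.

Local Open Scope ereal_scope.

Lemma lebesgue_outer_ge0 X : 0 <= lebesgue_outer X.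
Proof.
apply: le_ereal_inf_tmp => _ [c _ <-].
by apply: nneseries_ge0 => k _ _; rewrite lee_fin box_volume_ge0.
Qed.

Lemma lebesgue_outer0 : lebesgue_outer set0 = 0.
Proof.
apply/eqP; rewrite eq_le lebesgue_outer_ge0 andbT.
apply: ereal_inf_lbound; exists (fun=> (0%R, 0%R)); first exact: sub0set.
apply: eseries0 => k _ _; congr EFin.
by rewrite /box_volume big_ord_recl/= subrr maxxx mul0r.
Qed.

Lemma le_lebesgue_outer :
  {homo lebesgue_outer : X Y / X `<=` Y >-> X <= Y}.
Proof.
move=> X Y XY; apply/ereal_inf_le_tmp => _ [c Yc <-].
by exists c => //; apply: subset_trans XY Yc.
Qed.

Lemma lebesgue_outer_sigma_subadditive : sigma_subadditive lebesgue_outer.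
Proof.
move=> A; have [[i ioo]|] := pselect (exists i, lebesgue_outer (A i) = +oo).
  rewrite (eseries_pinfty _ _ ioo) ?leey// => k _.
  by rewrite -ltNye (lt_le_trans _ (lebesgue_outer_ge0 _)).
rewrite -forallNE => Aoo.
suff add2e (e : {posnum R}) : lebesgue_outer (\bigcup_k A k) <=
    \sum_(i <oo) lebesgue_outer (A i) + e%:num%:E.
  by apply/lee_addgt0Pr => _/posnumP[].
rewrite (le_trans _ (epsilon_trick _ _ _))//; last first.
  by move=> k; exact: lebesgue_outer_ge0.
pose v c := (box_volume c)%:E.
have v0 c : 0 <= v c by rewrite lee_fin box_volume_ge0.
pose Q k (c : nat -> 'cV[R]_n.+1 * 'cV[R]_n.+1) := box_cover (A k) c /\
  \sum_(j <oo) v (c j) <= lebesgue_outer (A k) + (e%:num / (2 ^ k.+1)%:R)%:E.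
have [G QG] : {G & forall k, Q k (G k)}.
  apply: (@choice _ _ Q) => k; rewrite /Q /lebesgue_outer.
  set S := (X in ereal_inf X); move infS : (ereal_inf S) => iS.
  case: iS infS => [r Sr|Soo|Soo].
  - have ek : (0 < e%:num / (2 ^ k.+1)%:R)%R by [].
    have /(lb_ereal_inf_adherent ek) : ereal_inf S \is a fin_num by rewrite Sr.
    move=> [_ [c Akc <-] xS].
    by exists c; split => //; rewrite -Sr; exact/ltW.
  - by have := Aoo k; rewrite /lebesgue_outer Soo.
  - suff : lbound S 0 by move/le_ereal_inf_tmp; rewrite Soo.
    by move=> _ [c _ <-]; apply: nneseries_ge0 => *; exact: v0.
have vG_ge0 x : 0 <= (v \o uncurry G) x by exact: v0.
apply: (@le_trans _ _ (\esum_(i in setT) (v \o uncurry G) i)).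
  rewrite /lebesgue_outer; apply: ereal_inf_lbound => /=.
  have /card_esym/ppcard_eqP[g] := card_nat2.
  exists (uncurry G \o g).
    move=> t [i _] /((QG i).1)[j _ Gijt].
    by exists (g^-1%FUN (i, j)) => //=; rewrite invK ?inE.
  rewrite -(esum_pred_image (v \o uncurry G) _ xpredT) ?[fun=> _]set_true//.
  by rewrite image_eq.
rewrite (_ : esum _ _ = \sum_(i <oo) \sum_(j <oo ) v (G i j)); last first.
  pose J : nat -> set (nat * nat) := fun i => [set (i, j) | j in setT].
  rewrite (_ : setT = \bigcup_k J k); last first.
    by rewrite predeqE => -[a b]; split => // _; exists a => //; exists b.
  rewrite esum_bigcupT /=; last 2 first.
    - apply/trivIsetP => i j _ _ ij.
      rewrite predeqE => -[x y] /=; split => //= -[] [_] _ [<-{x} _].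
      by move=> [y' _] [] /esym/eqP; rewrite (negbTE ij).
    - by move=> /= [x y]; exact: v0.
  rewrite -(image_id [set: nat]) -fun_true esum_pred_image//; last first.
    by move=> k _; exact: esum_ge0.
  apply: eq_eseriesr => /= j _.
  rewrite -(esum_pred_image (v \o uncurry G) (pair j) predT)//=; last first.
    by move=> ? ? _ _; exact: (@can_inj _ _ _ snd).
  by congr esum; rewrite predeqE => -[a b]; split; move=> [i _ <-]; exists i.
apply: lee_lim.
- apply: is_cvg_nneseries => k *.
  by apply: nneseries_ge0 => m *; exact: (vG_ge0 (k, m)).
- apply: is_cvg_nneseries => k *.
  by apply: adde_ge0 => //; exact: lebesgue_outer_ge0.
- by near=> k; apply: lee_sum => i _; exact: (QG i).2.
Unshelve. all: by end_near. Qed.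

HB.instance Definition _ := isOuterMeasure.Build R 'cV[R]_n.+1 lebesgue_outer
  lebesgue_outer0 lebesgue_outer_ge0 le_lebesgue_outer
  lebesgue_outer_sigma_subadditive.

End lebesgue_outer.

(* 'cV[R]_n.+1 with the sigma-algebra of Lebesgue measurable sets. *)
Definition Rn (R : realType) (n : nat) :=
  caratheodory_type (@lebesgue_outer R n).

HB.instance Definition _ (R : realType) (n : nat) :=
  Measurable.on (Rn R n).

Definition lebesgue_Rn (R : realType) (n : nat) : set (Rn R n) -> \bar R :=
  @lebesgue_outer R n.

HB.instance Definition _ (R : realType) (n : nat) :=
  isMeasure.Build _ (Rn R n) R (@lebesgue_Rn R n)
    (@lebesgue_outer0 R n) (@lebesgue_outer_ge0 R n)
    (@caratheodory_measure_sigma_additive R _ (@lebesgue_outer R n)).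

Definition enorm (R : realType) (n : nat) (x : 'cV[R]_n.+1) : R :=
  Num.sqrt (\sum_i x i 0 ^+ 2).

Definition is_dilation (R : realType) (n : nat) (A : 'M[R]_n.+1) : Prop :=
  forall z : R[i], eigenvalue (map_mx (real_complex R) A) z -> 1 < `|z|.

Section balls.
Variables (R : realType) (n : nat).
Implicit Types (A P : 'M[R]_n.+1) (r : R).

Definition ellipsoid P : set (Rn R n) := [set x | enorm (P *m x) < 1].

Definition adapted_ellipsoid A P r : Prop :=
  [/\ P \in unitmx, lebesgue_Rn (ellipsoid P) = 1%E, 1 < r,
      ellipsoid P `<=` (fun x : 'cV[R]_n.+1 => r *: x) @` ellipsoid P
    & (fun x : 'cV[R]_n.+1 => r *: x) @` ellipsoid P `<=`
      (fun x : 'cV[R]_n.+1 => A *m x) @` ellipsoid P].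

Definition dil_det A : R := `|\det A|.

(* B_k = A^k Delta, for k >= 0. *)
Definition dil_ball A P (k : nat) : set (Rn R n) :=
  (fun x : 'cV[R]_n.+1 => A ^+ k *m x) @` ellipsoid P.

(* The set with indicator function chi~_k: C_k = B_k \ B_(k-1) for k >= 1,
   and B_0 for k = 0. *)
Definition dil_ring A P (k : nat) : set (Rn R n) :=
  if k is j.+1 then dil_ball A P j.+1 `\` dil_ball A P j else dil_ball A P 0.

End balls.

Section variable_exponent.
Variables (R : realType) (n : nat).
Implicit Types (q g f : Rn R n -> R) (D : set (Rn R n)).

Definition variable_exponent q : Prop :=
  [/\ measurable_fun setT q, forall x, 1 <= q x,
      (1 < ess_inf (@lebesgue_Rn R n) (EFin \o q))%E
    & (ess_sup (@lebesgue_Rn R n) (EFin \o q) < +oo)%E].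

(* +oo when no lambda qualifies. *)
Definition vnorm D q f : \bar R :=
  ereal_inf [set l%:E | l in [set l : R | 0 < l /\
    (\int[@lebesgue_Rn R n]_(x in D) ((`|f x| / l) `^ q x)%:E <= 1)%E]].

Definition vLebesgue D q : set (Rn R n -> R) :=
  [set f | measurable_fun D f /\ (vnorm D q f < +oo)%E].

Definition vLebesgue_loc D q : set (Rn R n -> R) :=
  [set f | forall E : set 'cV[R]_n.+1, compact E -> E `<=` D ->
    f \in vLebesgue E q].

(* At x = 0 the inequality holds trivially, 0^-1 being 0. *)
Definition log_holder_origin g : Prop :=
  exists2 C : R, 0 < C & forall x,
    `|g x - g (0 : 'cV[R]_n.+1)| <= C / ln (expR 1 + (enorm x)^-1).

Definition log_holder_infty g (g_infty : R) : Prop :=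
  exists2 C : R, 0 < C & forall x,
    `|g x - g_infty| <= C / ln (expR 1 + enorm x).

End variable_exponent.

Section grand_herz.
Variables (R : realType) (n : nat).
Implicit Types (A P : 'M[R]_n.+1) (p theta : R) (alpha q f a : Rn R n -> R).
Local Open Scope ereal_scope.

Definition grand_lnorm p theta (u : nat -> \bar R) : \bar R :=
  ereal_sup [set ((eps `^ theta)%:E *
      \sum_(0 <= k <oo) u k `^ (p * (1 + eps))%R) `^ (p * (1 + eps))^-1%R
    | eps in [set eps : R | (0 < eps)%R]].

Definition herz_piece A P alpha f (k : nat) (x : Rn R n) : R :=
  (dil_det A `^ (k%:R * alpha x) * f x * \1_(dil_ring A P k) x)%R.

Definition herz_norm A P alpha q p theta f : \bar R :=
  grand_lnorm p theta (fun k => vnorm setT q (herz_piece A P alpha f k)).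

Definition grand_herz A P alpha q p theta : set (Rn R n -> R) :=
  [set f | f \in vLebesgue_loc setT q /\ herz_norm A P alpha q p theta f < +oo].

(* The support is the set where a does not vanish, not its closure (the balls
   are open). *)
Definition central_block A P q (alpha_infty : R) (l : nat) a : Prop :=
  [/\ measurable_fun setT a,
      [set x | a x != 0%R] `<=` dil_ball A P l
    & vnorm setT q a <= (dil_det A `^ (- (l%:R * alpha_infty)))%:E].

End grand_herz.

(* Main.v *)
Require Import Defs.
From mathcomp Require Import all_boot all_order all_algebra.
From mathcomp Require Import all_classical all_reals all_analysis.
From mathcomp Require Import complex measurable_realfun ring lra.

Set Implicit Arguments.
Unset Strict Implicit.
Unset Printing Implicit Defensive.

Import Order.TTheory GRing.Theory Num.Theory.
Import numFieldNormedType.Exports.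

Local Open Scope classical_set_scope.
Local Open Scope ring_scope.

(** Write [C_k] for the rings, [b] for [|det A|] and [chi_k] for the indicator
    function of [C_k].  The inclusions defining an adapted ellipsoid give
    [r^k Delta <= B_k], so for [k >= 1] a point of [C_k] has Euclidean norm at
    least a constant times [r^(k-1)].  Logarithmic Hölder continuity at infinity
    then bounds [k * |alpha x - alpha_infty|] on [C_k] uniformly in [k]
    ([log_holder_infty_ring]).  Since [b > 1] ([dil_det_gt1]), the weights
    [b^(k alpha)] and [b^(k alpha_infty)] are comparable there, and the norm of
    the [k]-th Herz piece of [f] is comparable with [b^(k alpha_infty)] times
    the norm of [f chi_k] ([ring_norms]).

    If [f] lies in the space, the coefficients
    [lambda_k = b^(k alpha_infty) * norm (f chi_k)] and the normalized
    restrictions [a_k = f chi_k / lambda_k] give the decomposition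
    ([grand_herz_blocks]).

    Conversely, a block with index [l < k] vanishes on [C_k], so by the triangle
    inequality the [k]-th piece of a partial sum of the block series has norm at
    most a constant times the sum over [l >= k] of [t^(l-k) |lambda_l|], where
    [t = b^(-alpha_infty) < 1]; the Fatou property of the Luxemburg norm
    ([luxemburg_fatou]) extends the bound to [f].  Young's inequality for this
    discrete convolution ([tail_young]) holds in every l^s with [s >= 1] with
    the same constant [1 / (1 - t)], hence it passes to the supremum over
    [eps] ([grand_lnorm_le], [grand_lnorm_tail]).

    Lebesgue measure being the Carathéodory extension of the volume of boxes,
    the measurability of balls and cubes is derived from that of half-spaces
    ([halfspace_measurable]). *)

(** * Lebesgue measurable sets and functions *)

Section lebesgue_measurability.
Variables (R : realType) (n : nat).

(* The two boxes into which the hyperplane of equation [x i 0 = t] cuts the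
   box [c]. *)
Let cut_le (i : 'I_n.+1) (t : R) (c : 'cV[R]_n.+1 * 'cV[R]_n.+1) :=
  (c.1, \col_j if j == i then Num.min (c.2 j 0) t else c.2 j 0).

Let cut_gt (i : 'I_n.+1) (t : R) (c : 'cV[R]_n.+1 * 'cV[R]_n.+1) :=
  (\col_j if j == i then Num.max (c.1 j 0) t else c.1 j 0, c.2).

Let box_volume_cut i t c :
  box_volume (cut_le i t c) + box_volume (cut_gt i t c) = box_volume c.
Proof.
have volE d : box_volume d = Num.max 0 (d.2 i 0 - d.1 i 0) *
    \prod_(j < n.+1 | j != i) Num.max 0 (d.2 j 0 - d.1 j 0).
  by rewrite /box_volume (bigD1 i).
rewrite !volE/= !mxE eqxx.
set x := \prod_(j < _ | _) _; set y := \prod_(j < _ | _) _.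
set z := \prod_(j < _ | _) _.
have -> : x = z by apply: eq_bigr => j /negPf ji; rewrite !mxE ji.
have -> : y = z by apply: eq_bigr => j /negPf ji; rewrite !mxE ji.
rewrite -mulrDl; congr (_ * _); move: (c.1 i 0) (c.2 i 0) => a b.
rewrite !maxEle !minEle; case: (leP b t) => bt; case: (leP a t) => ta;
  rewrite ?subrr ?addr0 ?add0r; do !case: leP => ?; lra.
Qed.

(** A hyperplane orthogonal to a coordinate axis cuts each box of a cover into
    two boxes whose volumes add up, which is Carathéodory's criterion. *)
Lemma halfspace_measurable (i : 'I_n.+1) (t : R) :
  measurable ([set x | x i 0 <= t] : set (Rn R n)).
Proof.
apply: le_caratheodory_measurable => X.
(* Every cover of [X] yields covers of both parts, of the same total volume. *)
apply: le_ereal_inf_tmp => _ [c Xc <-].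
rewrite (eq_eseriesr (g := fun k => ((box_volume (cut_le i t (c k)))%:E +
   (box_volume (cut_gt i t (c k)))%:E)%E)); last first.
  by move=> k _; rewrite -EFinD box_volume_cut.
rewrite nneseriesD; [|by move=> k _ _; rewrite lee_fin box_volume_ge0..].
apply: leeD; apply: ereal_inf_lbound.
- exists (fun k => cut_le i t (c k)) => // x [/Xc[k _ xk] xt].
  exists k => // j; have := xk j; rewrite !mxE; case: eqP => [->|//].
  by case/andP => -> ?; rewrite le_min xt andbT.
- exists (fun k => cut_gt i t (c k)) => // x [/Xc[k _ xk] /negP].
  rewrite -ltNge => xt.
  exists k => // j; have := xk j; rewrite !mxE; case: eqP => [->|//].
  by case/andP => ? ->; rewrite gt_max xt !andbT.
Qed.

Lemma measurable_coord (i : 'I_n.+1) :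
  measurable_fun setT (fun x : Rn R n => x i 0).
Proof.
apply: (measurability _ (RGenOInfty.measurableE R)) => // _ [_ [x ->] <-].
rewrite setTI [X in measurable X](_ : _ = ~` [set y : Rn R n | y i 0 <= x]).
  by apply: measurableC; exact: halfspace_measurable.
by apply/seteqP; split => y /=; rewrite in_itv /= andbT ltNge => /negP.
Qed.

Lemma measurable_enorm_mul (M : 'M[R]_n.+1) :
  measurable_fun setT (fun x : Rn R n => enorm (M *m x)).
Proof.
rewrite /enorm; apply: (measurableT_comp (f := @Num.sqrt R)).
  by apply: continuous_measurable_fun; exact: sqrt_continuous.
apply: measurable_sum => i; apply: measurable_funX.
rewrite (_ : (fun _ => _) = fun x : Rn R n => \sum_j M i j * x j 0); last first.
  by apply/funext => x; rewrite mxE.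
apply: (@measurable_sum _ _ _ _ _ _ (fun j (x : Rn R n) => M i j * x j 0)) => j.
exact: (measurableT_comp (mulrl_measurable (D := setT) (M i j))
  (measurable_coord j)).
Qed.

Lemma lebesgue_Rn_complete : measure_is_complete (@lebesgue_Rn R n).
Proof. exact: measure_is_complete_caratheodory. Qed.

End lebesgue_measurability.

(** * Integrals and measurability on abstract measure spaces *)

Section nonneg_integral.
Local Open Scope ereal_scope.

(** Monotonicity without any measurability hypothesis: the integral of a
    nonnegative function is a supremum over the simple functions below it. *)
Lemma le_integral_nonneg d (T : measurableType d) (R : realType)
    (mu : {measure set T -> \bar R}) (f g : T -> \bar R) :
  (forall x, 0 <= f x) -> (forall x, f x <= g x) ->
  \int[mu]_x f x <= \int[mu]_x g x.
Proof.
move=> f0 fg; have g0 x : 0 <= g x := le_trans (f0 x) (fg x).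
rewrite !ge0_integralTE//; apply: ereal_sup_le => _ [h hf <-].
by exists h => // x; exact: le_trans (hf x) (fg x).
Qed.

Lemma integral_nonneg_lin d (T : measurableType d) (R : realType)
    (mu : {measure set T -> \bar R}) (f g : T -> R) (a b : R) :
  measurable_fun setT f -> measurable_fun setT g ->
  (forall x, 0 <= f x)%R -> (forall x, 0 <= g x)%R ->
  (0 <= a)%R -> (0 <= b)%R ->
  \int[mu]_x (a * f x + b * g x)%:E =
  a%:E * \int[mu]_x (f x)%:E + b%:E * \int[mu]_x (g x)%:E.
Proof.
move=> /measurable_EFinP mf /measurable_EFinP mg f0 g0 a0 b0.
rewrite -!ge0_integralZl_EFin//; last 2 first.
- by move=> x _; rewrite lee_fin.
- by move=> x _; rewrite lee_fin.
rewrite -ge0_integralD//.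
- by move=> x _; rewrite mule_ge0// lee_fin.
- exact: measurable_funeM.
- by move=> x _; rewrite mule_ge0// lee_fin.
- exact: measurable_funeM.
Qed.

End nonneg_integral.

Lemma measurable_fun_powR_exp d (T : measurableType d) (R : realType)
    (f g : T -> R) : measurable_fun setT f -> measurable_fun setT g ->
  measurable_fun setT (fun x => f x `^ g x).
Proof.
move=> mf mg; rewrite /powR; apply: measurable_fun_ifT.
- exact: (measurable_fun_eqr mf (measurable_cst (0 : R))).
- apply: (measurableT_comp (f := fun b : bool => b%:R : R)) => //.
  exact: (measurable_fun_eqr mg (measurable_cst (0 : R))).
- apply: measurableT_comp => //; apply: measurable_funM => //.
  by apply: measurableT_comp.
Qed.

Lemma measurable_mul_indic d (T : measurableType d) (R : realType) (f : T -> R)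
    (C : set T) : measurable_fun setT f -> measurable C ->
  measurable_fun setT (fun x => f x * \1_C x).
Proof.
by move=> mf mC; apply: measurable_funM => //; exact: measurable_indic.
Qed.

(** Outside a negligible set [f] is a pointwise limit of measurable functions,
    and completeness allows arbitrary values on that set. *)
Lemma measurable_fun_ae_cvg d (T : measurableType d) (R : realType)
    (mu : {measure set T -> \bar R}) (F : nat -> T -> R) (f : T -> R) :
  measure_is_complete mu -> (forall k, measurable_fun setT (F k)) ->
  {ae mu, forall x, F^~ x @ \oo --> f x} -> measurable_fun setT f.
Proof.
move=> cmu mF [N [mN N0 NF]]; apply/measurable_EFinP.
apply: (ae_measurable_fun cmu (f := EFin \o (fun x => f x * \1_(~` N) x))).
  exists N; split => // x; apply: contra_notP => xN _ /=.
  by rewrite indicE mem_set ?mulr1.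
apply/measurable_EFinP.
apply: (@measurable_fun_cvg _ _ _ _ (fun k x => F k x * \1_(~` N) x)).
  by move=> k; apply: measurable_mul_indic => //; exact: measurableC.
move=> x _; rewrite indicE; case: (boolP (x \in _)) => [/set_mem xN|_].
  by apply: cvgMl; apply: contra_notP xN => xF; exact: NF.
by rewrite mulr0; under eq_fun do rewrite mulr0; exact: cvg_cst.
Qed.

Lemma measurable_weighted d (T : measurableType d) (R : realType) (b c : R)
    (al f : T -> R) (C : set T) : measurable_fun setT al ->
  measurable_fun setT f -> measurable C ->
  measurable_fun setT (fun x => b `^ (c * al x) * f x * \1_C x).
Proof.
move=> mal mf mC; apply: measurable_mul_indic => //; apply: measurable_funM => //.
apply: (measurableT_comp (measurable_powRr b)).
exact: (measurableT_comp (mulrl_measurable (D := setT) c) mal).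
Qed.

(** * Powers with real exponent *)

Lemma cvg_powR (R : realType) (s l : R) (u : nat -> R) : 1 <= s ->
  (forall k, 0 <= u k) -> u @ \oo --> l -> (fun k => u k `^ s) @ \oo --> l `^ s.
Proof.
move=> s1 u0 ul; have s0 : 0 < s := lt_le_trans ltr01 s1.
have l0 : 0 <= l by apply: cvgr_to_ge ul _; exact: nearW.
move: l0; rewrite le_eqVlt => /predU1P[l0|l0]; last first.
  apply: (cvg_comp u (fun y => y `^ s) ul).
  have : derivable (fun y : R => y `^ s) l 1.
    by apply: derivable_powR; rewrite in_itv /= l0.
  by move/derivable1_diffP/differentiable_continuous.
rewrite -l0 powR0 ?gt_eqF//; apply: (@squeeze_cvgr _ _ _ _ (fun=> 0) u).
- have : \forall k \near \oo, u k < 1.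
    by apply: (cvgr_lt l ul); rewrite -l0.
  apply: filterS => k uk1; rewrite powR_ge0 /=.
  have := u0 k; rewrite le_eqVlt => /predU1P[<-|uk0].
    by rewrite powR0 ?gt_eqF.
  by apply: ge1r_powR => //; rewrite uk0 ltW.
- exact: cvg_cst.
- by rewrite l0.
Qed.

(** Convexity of the power, the two weights being written [t] and [1 - t]. *)
Lemma powR_conv (R : realType) (s t x y : R) : 1 <= s -> 0 <= t <= 1 ->
  0 <= x -> 0 <= y ->
  (t * x + (1 - t) * y) `^ s <= t * x `^ s + (1 - t) * y `^ s.
Proof.
move=> s1 /andP[t0 t1] x0 y0.
have := convex_powR s1 (Itv01 t0 t1) (x := x) (y := y).
by rewrite !inE /= !in_itv /= x0 y0 => /(_ isT isT); rewrite !convRE.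
Qed.

(** * The Luxemburg norm with variable exponent *)

Section luxemburg_norm.
Context d (T : measurableType d) (R : realType).
Variables (mu : {measure set T -> \bar R}) (q : T -> R).
Hypotheses (mq : measurable_fun setT q) (q1 : forall x, 1 <= q x).
Implicit Types (f g : T -> R) (l c : R).

(** The Luxemburg norm of an arbitrary measure space; for Lebesgue measure on
    the Euclidean space it is convertible to [vnorm]. *)
Definition luxemburg (D : set T) (r f : T -> R) : \bar R :=
  ereal_inf [set l%:E | l in [set l : R | 0 < l /\
    (\int[mu]_(x in D) ((`|f x| / l) `^ r x)%:E <= 1)%E]].

(** The modular of [f / l], whose sublevel set at height 1 defines the
    Luxemburg norm. *)
Definition modular f l : \bar R :=
  (\int[mu]_x ((`|f x| / l) `^ q x)%:E)%E.

Lemma modular_antitone f l l' : 0 < l -> l <= l' ->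
  (modular f l' <= modular f l)%E.
Proof.
move=> l0 ll'; have l'0 := lt_le_trans l0 ll'.
apply: le_integral_nonneg => x; rewrite lee_fin ?powR_ge0//.
apply: ge0_ler_powR; rewrite ?nnegrE ?(le_trans _ (q1 x))//.
- by rewrite divr_ge0// ltW.
- by rewrite divr_ge0// ltW.
- by rewrite ler_wpM2l// lef_pV2.
Qed.

Lemma luxemburg_ge0 (D : set T) (r : T -> R) f : (0 <= luxemburg D r f)%E.
Proof.
by apply: le_ereal_inf_tmp => _ [l [l0 _] <-]; rewrite lee_fin ltW.
Qed.

Lemma luxemburg_le_modular f l : 0 < l -> (modular f l <= 1)%E ->
  (luxemburg setT q f <= l%:E)%E.
Proof. by move=> l0 fl; apply: ereal_inf_lbound; exists l. Qed.

(** The inequality is strict, the infimum not being known to be attained. *)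
Lemma luxemburg_lt_modular f l : (luxemburg setT q f < l%:E)%E ->
  0 < l /\ (modular f l <= 1)%E.
Proof.
move=> fl; split; first by rewrite -lte_fin (le_lt_trans _ fl)// luxemburg_ge0.
have [_ [l' [l'0 fl'] <-] l'l] := ereal_inf_lt fl.
by apply: le_trans fl'; apply: modular_antitone => //; rewrite -lee_fin ltW.
Qed.

(** Upper bounds of the norm are proved at every level above the bound. *)
Lemma luxemburg_le f (a : \bar R) : (0 <= a)%E ->
  (forall l, (a < l%:E)%E -> (modular f l <= 1)%E) -> (luxemburg setT q f <= a)%E.
Proof.
case: a => [a| |]; [|by move=> _ _; exact: leey|by rewrite leeNy_eq].
rewrite lee_fin => a0 fa; apply/lee_addgt0Pr => e e0.
have ae : a < a + e by rewrite ltrDl.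
apply: luxemburg_le_modular; first exact: le_lt_trans ae.
by apply: fa; rewrite lte_fin.
Qed.

(** Monotonicity and positive homogeneity in one statement. *)
Lemma luxemburg_mono f g c : 0 <= c -> (forall x, `|f x| <= c * `|g x|) ->
  (luxemburg setT q f <= c%:E * luxemburg setT q g)%E.
Proof.
move=> c0 fg; apply: luxemburg_le => [|l].
  by rewrite mule_ge0// ?lee_fin// luxemburg_ge0.
move: c0; rewrite le_eqVlt => /predU1P[c0|c0].
  rewrite -c0 mul0e lte_fin => l0; rewrite /modular integral0_eq ?lee01// => x _.
  have /eqP -> : `|f x| == 0.
    by rewrite -normr_le0 normr_id (le_trans (fg x))// -c0 mul0r.
  by rewrite mul0r powR0// gt_eqF// (lt_le_trans ltr01).
rewrite -lte_pdivlMl// -EFinM mulrC => /luxemburg_lt_modular[lc]; apply: le_trans.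
have l0 : 0 < l by move: lc; rewrite pmulr_lgt0// invr_gt0.
apply: le_integral_nonneg => x; rewrite lee_fin ?powR_ge0//.
apply: ge0_ler_powR; rewrite ?nnegrE ?(le_trans _ (q1 x))//.
- by rewrite divr_ge0// ltW.
- by rewrite divr_ge0// ltW.
- by rewrite invfM invrK (mulrC l^-1) mulrA ler_pM2r ?invr_gt0// (mulrC _ c).
Qed.

(** Enlarging the domain of integration; [D] may fail to be measurable. *)
Lemma luxemburg_sub_domain (D : set T) f g : (forall x, D x -> f x = g x) ->
  (luxemburg D q f <= luxemburg setT q g)%E.
Proof.
move=> fg; apply: le_ereal_inf_tmp => _ [l [l0 gl] <-].
apply: ereal_inf_lbound; exists l; [split; [exact: l0|]|by []].
apply: le_trans gl.
rewrite integral_mkcond; apply: le_integral_nonneg => x; rewrite patchE;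
  case: ifPn => // xD; rewrite ?lee_fin ?powR_ge0//.
by rewrite fg//; rewrite inE in xD.
Qed.

Lemma measurable_modular f l : measurable_fun setT f ->
  measurable_fun setT (fun x => (`|f x| / l) `^ q x).
Proof.
move=> mf; apply: measurable_fun_powR_exp mq.
exact: (measurableT_comp (mulrr_measurable (D := setT) l^-1)
  (measurableT_comp (normr_measurable (D := setT)) mf)).
Qed.

(** Triangle inequality, by convexity of [y |-> y ^ q x] with the weights
    [l / (l + m)] and [m / (l + m)], where [l] and [m] are levels slightly above
    the two norms. *)
Lemma luxemburgD f g : measurable_fun setT f -> measurable_fun setT g ->
  (luxemburg setT q (fun x => f x + g x)%R <=
   luxemburg setT q f + luxemburg setT q g)%E.
Proof.
move=> mf mg.
have fg0 := adde_ge0 (luxemburg_ge0 setT q f) (luxemburg_ge0 setT q g).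
apply: luxemburg_le => // k.
move E : (luxemburg setT q f) fg0 => a; move F : (luxemburg setT q g) => b.
have a0 : (0 <= a)%E by rewrite -E luxemburg_ge0.
have b0 : (0 <= b)%E by rewrite -F luxemburg_ge0.
case: a b E F a0 b0 => [a| |] [b| |] E F; rewrite ?leeNy_eq// !lee_fin.
rewrite lte_fin => a0 b0 _ abk.
pose e := (k - a - b) / 2; pose l := a + e; pose m := b + e.
(* The excess of [k] over the sum of the norms is shared out equally. *)
have e0 : 0 < e by rewrite divr_gt0//; lra.
have [l0 fl] : 0 < l /\ (modular f l <= 1)%E.
  by apply: luxemburg_lt_modular; rewrite E lte_fin ltrDl.
have [m0 gm] : 0 < m /\ (modular g m <= 1)%E.
  by apply: luxemburg_lt_modular; rewrite F lte_fin ltrDl.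
have kE : k = l + m by rewrite /l /m /e; lra.
pose t := l / k; have k0 : 0 < k by rewrite kE addr_gt0.
have t0 : 0 <= t by rewrite divr_ge0// ltW.
have t1 : t <= 1 by rewrite ler_pdivrMr// mul1r kE lerDl ltW.
have t1' : 0 <= 1 - t by rewrite subr_ge0.
apply: (@le_trans _ _ (t%:E * modular f l + (1 - t)%:E * modular g m)%E).
  rewrite -integral_nonneg_lin//; last 4 first.
  - exact: measurable_modular.
  - exact: measurable_modular.
  - by move=> x; exact: powR_ge0.
  - by move=> x; exact: powR_ge0.
  apply: le_integral_nonneg => x; rewrite lee_fin ?powR_ge0//.
  apply: le_trans (powR_conv (q1 x) _ _ _); rewrite ?t0 ?t1//; last 2 first.
  - by rewrite divr_ge0// ltW.
  - by rewrite divr_ge0// ltW.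
  have m_k : 1 - t = m / k by rewrite /t kE; field; rewrite -kE gt_eqF.
  apply: ge0_ler_powR; rewrite ?nnegrE ?(le_trans _ (q1 x))//.
  - by rewrite divr_ge0// ltW.
  - by rewrite addr_ge0// mulr_ge0// divr_ge0// ltW.
  rewrite m_k /t [l / k * _]mulrC [m / k * _]mulrC !mulrA.
  rewrite !divfK ?gt_eqF// -mulrDl ler_pM2r ?invr_gt0//.
  exact: ler_normD.
apply: (@le_trans _ _ (t%:E * 1 + (1 - t)%:E * 1)%E).
  by apply: leeD; [apply: (lee_wpmul2l _ fl)|apply: (lee_wpmul2l _ gm)];
    rewrite lee_fin.
by rewrite !mule1 -EFinD lee_fin; lra.
Qed.

Lemma luxemburg0 : luxemburg setT q (fun=> 0) = 0%E.
Proof.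
apply/eqP; rewrite eq_le luxemburg_ge0 andbT.
have := @luxemburg_mono (fun=> 0) (fun=> 0) 0 (lexx _).
by rewrite mul0e; apply => x; rewrite normr0 mulr0.
Qed.

Lemma luxemburg_sum (I : Type) (s : seq I) (F : I -> T -> R) :
  (forall i, measurable_fun setT (F i)) ->
  (luxemburg setT q (fun x => (\sum_(i <- s) F i x)%R) <=
   \sum_(i <- s) luxemburg setT q (F i))%E.
Proof.
move=> mF; elim: s => [|i s IH].
  rewrite big_nil [X in luxemburg _ _ X](_ : _ = fun=> 0) ?luxemburg0//.
  by apply/funext => x; rewrite big_nil.
rewrite big_cons; apply: le_trans (leeD (lexx _) IH).
rewrite [X in luxemburg _ _ X](_ : _ = fun x =>
    F i x + (\sum_(j <- s) F j x)); first by
  apply: luxemburgD => //; exact: measurable_sum.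
by apply/funext => x; rewrite big_cons.
Qed.

(** Fatou property of the norm. *)
Lemma luxemburg_fatou (F : nat -> T -> R) f (a : \bar R) :
  (forall k, measurable_fun setT (F k)) -> measurable_fun setT f ->
  {ae mu, forall x, F^~ x @ \oo --> f x} ->
  (forall k, luxemburg setT q (F k) <= a)%E -> (luxemburg setT q f <= a)%E.
Proof.
move=> mF mf Ff Fa; apply: luxemburg_le.
  exact: le_trans (luxemburg_ge0 _ _ _) (Fa 0%N).
move=> l al; have Fl k : 0 < l /\ (modular (F k) l <= 1)%E.
  by apply: luxemburg_lt_modular; exact: le_lt_trans al.
have l0 := (Fl 0%N).1.
pose G k x := ((`|F k x| / l) `^ q x)%:E.
have mG k : measurable_fun setT (G k).
  by apply/measurable_EFinP; exact: measurable_modular.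
apply: (@le_trans _ _ (\int[mu]_x limn_einf (G^~ x))%E).
  apply: ae_ge0_le_integral => //.
  - by move=> x _; rewrite lee_fin powR_ge0.
  - by apply/measurable_EFinP; exact: measurable_modular.
  - move=> x _; rewrite limn_einf_lim; apply: lime_ge.
      exact: is_cvg_einfs.
    apply: nearW => k; apply: le_ereal_inf_tmp => _ [j _ <-].
    by rewrite lee_fin powR_ge0.
  - rewrite (_ : (fun _ => _) = fun x => - limn_esup (fun k => - G k x))%E//.
    apply: measurableT_comp => //; apply: measurable_fun_limn_esup => k.
    by apply: measurableT_comp => //.
  apply: filterS Ff => x Fx _.
  have Gx : G^~ x @ \oo --> ((`|f x| / l) `^ q x)%:E.
    apply: cvg_EFin; first exact: nearW.
    apply: (cvg_powR (u := fun k => `|F k x| / l) (q1 x)) => [k|].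
      by rewrite divr_ge0// ltW.
    by apply: cvgMl; exact: cvg_norm.
  by rewrite (cvg_limn_einf_sup Gx).1.
apply: le_trans (fatou _ _ _ _) _ => //.
  by move=> k x _; rewrite lee_fin powR_ge0.
rewrite limn_einf_lim; apply: lime_le; first exact: is_cvg_einfs.
apply: nearW => k; apply: le_trans (Fl k).2.
by apply: ereal_inf_lbound; exists k => /=.
Qed.

(** For [l <= 1] the modular of [f / l] is at least the modular of [f] divided
    by [l], because the exponent is at least 1. *)
Lemma luxemburg_eq0 f : measurable_fun setT f -> luxemburg setT q f = 0%E ->
  {ae mu, forall x, f x = 0}.
Proof.
move=> mf f0.
have mf1 := measurable_modular 1 mf.
have fl l : 0 < l -> l <= 1 -> (modular f 1 <= l%:E)%E.
  move=> l0 l1; have [_ ml] : 0 < l /\ (modular f l <= 1)%E.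
    by apply: luxemburg_lt_modular; rewrite f0 lte_fin.
  have l'0 : 0 <= l^-1 by rewrite invr_ge0 ltW.
  have : (l^-1%:E * modular f 1 <= modular f l)%E.
    rewrite -[leLHS]adde0 -(mul0e (modular f 1)).
    rewrite -integral_nonneg_lin//.
    apply: le_integral_nonneg => x; rewrite lee_fin mul0r addr0.
      by rewrite mulr_ge0 ?powR_ge0.
    rewrite divr1 powRM// mulrC ler_wpM2l ?powR_ge0//.
    by apply: le1r_powR => //; rewrite invf_ge1.
  by move=> /le_trans/(_ ml); rewrite lee_pdivrMl// mule1.
have : (\int[mu]_x `|((`|f x| / 1) `^ q x)%:E| = 0)%E.
  apply/eqP; rewrite eq_le integral_ge0// andbT.
  rewrite (_ : (fun _ => _) = fun x => ((`|f x| / 1) `^ q x)%:E); last first.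
    by apply/funext => x; rewrite gee0_abs// lee_fin powR_ge0.
  apply/lee_addgt0Pr => e e0; rewrite add0e.
  apply: le_trans (fl (Num.min e 1) _ _) _.
  - by rewrite lt_min e0 ltr01.
  - by rewrite ge_min lexx orbT.
  - by rewrite lee_fin ge_min lexx.
move/(ae_eq_integral_abs _ measurableT ((measurable_EFinP _ _).2 mf1)).
apply: filterS => x /(_ I) /= [].
by rewrite divr1 => /powR_eq0_eq0/normr0_eq0.
Qed.

End luxemburg_norm.

(** * Dilations and their balls *)

Section euclidean_norm.
Variables (R : realType) (n : nat).
Implicit Types x : 'cV[R]_n.+1.

Lemma enorm_ge0 x : 0 <= enorm x. Proof. exact: sqrtr_ge0. Qed.

Lemma enormZ (c : R) x : enorm (c *: x) = `|c| * enorm x.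
Proof.
rewrite /enorm -sqrtr_sqr -sqrtrM ?sqr_ge0// mulr_sumr; congr Num.sqrt.
by apply: eq_bigr => i _; rewrite mxE exprMn.
Qed.

Lemma ler_enorm_coord x (i : 'I_n.+1) : `|x i 0| <= enorm x.
Proof.
rewrite /enorm -sqrtr_sqr ler_sqrt ?sumr_ge0// => [|j _]; last exact: sqr_ge0.
by rewrite (bigD1 i)//= lerDl sumr_ge0// => j _; exact: sqr_ge0.
Qed.

Lemma ler_enorm_sum x : enorm x <= \sum_i `|x i 0|.
Proof.
rewrite -[leRHS]ger0_norm ?sumr_ge0// -sqrtr_sqr ler_sqrt ?sqr_ge0//.
rewrite expr2 mulr_suml; apply: ler_sum => i _.
rewrite -real_normK ?num_real// expr2 ler_wpM2l//.
by rewrite (bigD1 i)//= lerDl sumr_ge0.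
Qed.

Lemma enorm_mulmx_bound (M : 'M[R]_n.+1) :
  exists2 c : R, 1 <= c & forall x, enorm (M *m x) <= c * enorm x.
Proof.
exists (1 + \sum_i \sum_j `|M i j|).
  by rewrite lerDl sumr_ge0// => i _; rewrite sumr_ge0.
move=> x; apply: le_trans (ler_enorm_sum _) _.
rewrite mulrDl mul1r; apply: ler_wpDl; first exact: enorm_ge0.
rewrite mulr_suml; apply: ler_sum => i _; rewrite mxE.
apply: le_trans (ler_norm_sum _ _ _) _; rewrite mulr_suml.
by apply: ler_sum => j _; rewrite normrM ler_wpM2l// ler_enorm_coord.
Qed.

End euclidean_norm.

(** A consequence of Bernoulli's inequality. *)
Lemma exprn_unbounded (R : realType) (r c : R) : 1 < r ->
  exists k, c < r ^+ k.
Proof.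
move=> r1; have bern k : 1 + k%:R * (r - 1) <= r ^+ k.
  elim: k => [|k IH]; first by rewrite mul0r addr0 expr0.
  rewrite exprSr; apply: (@le_trans _ _ ((1 + k%:R * (r - 1)) * r)).
    rewrite -subr_ge0 -natr1 [leRHS](_ : _ = k%:R * (r - 1) ^+ 2); last by ring.
    by rewrite mulr_ge0 ?sqr_ge0.
  by rewrite ler_wpM2r// ltW// (lt_trans ltr01).
exists (Num.truncn (c / (r - 1))).+1; apply: lt_le_trans (bern _).
rewrite ltr_wpDl// -ltr_pdivrMr ?subr_gt0//.
exact: truncnS_gt.
Qed.

Section dilation_balls.
Variables (R : realType) (n : nat) (A P : 'M[R]_n.+1) (r : R).
Hypotheses (dilA : is_dilation A) (adP : adapted_ellipsoid A P r).
Implicit Types (x y : 'cV[R]_n.+1) (k : nat).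

(** The determinant is the product of the complex eigenvalues. *)
Lemma dil_det_gt1 : 1 < dil_det A.
Proof.
pose B := map_mx (real_complex R) A.
have [s Bs] := closed_field_poly_normal (char_poly B).
rewrite (monicP (char_poly_monic B)) scale1r in Bs.
have s1 z : z \in s -> 1 < `|z|.
  move=> zs; apply: dilA; rewrite eigenvalue_root_char Bs.
  by rewrite root_prod_XsubC.
have sn : size s = n.+1.
  have := size_char_poly B; rewrite Bs size_prod_XsubC => -[].
  exact.
have detB : `|\det B| = \prod_(z <- s) `|z|.
  have := char_poly_det B; rewrite -horner_coef0 Bs horner_prod.
  move=> /(congr1 Num.norm); rewrite normrM normrX normrN1 expr1n mul1r => <-.
  rewrite normr_prod; apply: eq_bigr => z _.
  by rewrite hornerXsubC sub0r normrN.
have detA : `|\det B| = (dil_det A)%:C%C.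
  by rewrite /B det_map_mx/= normc_def/= expr0n addr0 sqrtr_sqr.
suff : 1 < \prod_(z <- s) `|z| by rewrite -detB detA ltcR.
case: s sn s1 {Bs detB} => // z s _ zs; rewrite big_cons.
have s1 : 1 <= \prod_(j <- s) `|j|.
  rewrite big_seq; elim/big_ind : _ => // [u v u1 v1|j js].
    by rewrite mulr_ege1.
  by rewrite ltW// zs// inE js orbT.
apply: lt_le_trans (zs z (mem_head _ _)) _.
by rewrite ler_peMr.
Qed.

Lemma dilation_unitmx : A \in unitmx.
Proof.
rewrite unitmxE unitfE -normr_gt0; exact: lt_trans ltr01 dil_det_gt1.
Qed.

(** In terms of sets, [r^k Delta] is contained in [B_k]. *)
Lemma sub_dil_ball_scale k x : enorm (P *m x) < r ^+ k -> dil_ball A P k x.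
Proof.
have [_ _ r1 _ rA] := adP; have r0 : 0 < r := lt_trans ltr01 r1.
have scaleB y : ellipsoid P y -> dil_ball A P k (r ^+ k *: y).
  elim: k y => [|k IH] y y1.
    by exists y; rewrite ?expr0 ?mul1mx ?scale1r.
  have [|z z1 zE] := rA (r *: y); first by exists y.
  have [w w1 wE] := IH z z1.
  exists w => //; rewrite (exprSr r) -scalerA -zE scalemxAr -wE.
  by rewrite exprS -mulmxE mulmxA.
move=> xr; have -> : x = r ^+ k *: ((r ^+ k)^-1 *: x).
  by rewrite scalerA divff ?scale1r// expf_neq0// gt_eqF.
apply: scaleB; rewrite /ellipsoid /= -scalemxAr enormZ.
rewrite ger0_norm ?invr_ge0 ?exprn_ge0 ?(ltW r0)//.
by rewrite mulrC ltr_pdivrMr ?mul1r ?exprn_gt0.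
Qed.

Lemma dil_ballS k : dil_ball A P k `<=` dil_ball A P k.+1.
Proof.
have [_ _ _ Dr rA] := adP.
move=> _ [y /Dr/rA [z z1 <-] <-]; exists z => //.
by rewrite exprSr -mulmxE mulmxA.
Qed.

Lemma sub_dil_ball j k : (j <= k)%N -> dil_ball A P j `<=` dil_ball A P k.
Proof.
elim: k => [|k IH]; first by rewrite leqn0 => /eqP ->.
rewrite leq_eqVlt => /predU1P[->//|jk].
exact: subset_trans (IH jk) (@dil_ballS k).
Qed.

Lemma enorm_le_sub_dil_ball (c : R) :
  exists k, [set x | enorm x <= c] `<=` dil_ball A P k.
Proof.
have [_ _ r1 _ _] := adP; have [d d1 Pd] := enorm_mulmx_bound P.
have [k ck] := exprn_unbounded (d * c) r1; exists k => x /= xc.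
apply: sub_dil_ball_scale; apply: le_lt_trans (Pd x) (le_lt_trans _ ck).
by rewrite ler_wpM2l// (le_trans ler01).
Qed.

(** The rings partition the space: [k0] is the first index of a ball that
    contains [x]. *)
Lemma dil_ring_indicE x :
  exists k0, forall k, \1_(dil_ring A P k) x = (k == k0)%:R :> R.
Proof.
have [k xk] := enorm_le_sub_dil_ball (enorm x).
have ex : exists k, `[< dil_ball A P k x >].
  by exists k; apply/asboolP/xk => /=.
case: (ex_minnP ex) => k0 /asboolP xk0 k0min; exists k0 => j.
have ball_lt i : (i < k0)%N -> ~ dil_ball A P i x.
  by move=> ik0 /asboolP/k0min; rewrite leqNgt ik0.
rewrite indicE; congr (_%:R : R); congr nat_of_bool; apply/idP/eqP.
  rewrite inE; case: j => [|j] /=.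
    by move=> x0; case: k0 {ex k0min xk0} ball_lt => // k0 /(_ 0%N isT).
  move=> [xj xnj]; apply/eqP; rewrite eqn_leq k0min ?andbT; last exact/asboolP.
  rewrite ltnNge; apply/negP => k0j; apply: xnj.
  exact: sub_dil_ball xk0.
move=> ->; rewrite inE; case: k0 xk0 ball_lt {ex k0min} => //= k0 xk0 ball_lt.
by split => //; exact: ball_lt.
Qed.

Lemma dil_ringS_enorm k x : dil_ring A P k.+1 x -> r ^+ k <= enorm (P *m x).
Proof.
by move=> [_ xk]; rewrite leNgt; apply/negP => /sub_dil_ball_scale.
Qed.

Lemma sub_dil_ring_ball k : dil_ring A P k `<=` dil_ball A P k.
Proof. by case: k => //= k x []. Qed.

Lemma dil_ring_ball_disj k l x : dil_ring A P k x -> dil_ball A P l x ->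
  (k <= l)%N.
Proof.
case: k => // k [_ xk] xl; rewrite ltnNge; apply/negP => lk; apply: xk.
exact: sub_dil_ball xl.
Qed.

Lemma measurable_dil_ball k : measurable (dil_ball A P k).
Proof.
have Ak : A ^+ k \in unitmx by rewrite unitrX// dilation_unitmx.
rewrite (_ : dil_ball _ _ _ =
    [set x : Rn R n | enorm (P *m invmx (A ^+ k) *m x) < 1]).
  have := @measurable_enorm_mul R n (P *m invmx (A ^+ k)).
  move=> /(_ measurableT `]-oo, 1[%classic).
  rewrite setTI preimage_itvNyo; apply.
  exact: measurable_itv.
apply/seteqP; split => [_ [y y1 <-]|x x1].
  by rewrite /= -mulmxA mulKmx.
exists (invmx (A ^+ k) *m x); first by rewrite /ellipsoid /= mulmxA.
by rewrite mulKVmx.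
Qed.

Lemma measurable_dil_ring k : measurable (dil_ring A P k).
Proof.
case: k => [|k] /=; first exact: measurable_dil_ball.
by apply: measurableD; exact: measurable_dil_ball.
Qed.

(** On the [k]-th ring, [ln (e + |x|)] grows at least linearly in [k], so that
    logarithmic Hölder continuity at infinity bounds [k * |g x - ginf|]. *)
Lemma log_holder_infty_ring (g : Rn R n -> R) (ginf : R) :
  log_holder_infty g ginf ->
  exists2 c : R, 0 <= c &
    forall k x, dil_ring A P k x -> k%:R * `|g x - ginf| <= c.
Proof.
move=> [C C0 gC]; have [_ _ r1 _ _] := adP.
have r0 : 0 < r := lt_trans ltr01 r1.
have lnr : 0 < ln r by rewrite ln_gt0.
have [d d1 Pd] := enorm_mulmx_bound P; have d0 := lt_le_trans ltr01 d1.
have lnd : 0 <= ln d by rewrite ln_ge0.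
(* The point [x] of the ring of index [k.+1] satisfies
   [k * ln r <= L + ln d] and [1 <= L], whence [k.+1 <= c * L]. *)
pose c := (1 + ln d) / ln r + 1.
have c0 : 0 <= c by rewrite addr_ge0// divr_ge0 ?(ltW lnr)// addr_ge0.
exists (c * C); first by rewrite mulr_ge0// ltW.
move=> k x xk; pose L := ln (expR 1 + enorm x).
have e0 : 0 < expR 1 + enorm x.
  by rewrite ltr_pwDl ?expR_gt0 ?enorm_ge0.
have L1 : 1 <= L.
  rewrite /L -[leLHS](@expRK R) ler_ln ?posrE ?expR_gt0//.
  by rewrite lerDl enorm_ge0.
have kL : k%:R <= c * L.
  case: k xk => [|k] xk; first by rewrite mulr_ge0// (le_trans ler01).
  have : k%:R * ln r <= L + ln d.
    rewrite mulr_natl -lnXn// /L -lnM ?posrE//.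
    rewrite ler_ln ?posrE ?exprn_gt0 ?mulr_gt0//.
    apply: le_trans (dil_ringS_enorm xk) _; apply: le_trans (Pd x) _.
    by rewrite mulrC ler_pM2r// lerDr expR_ge0.
  rewrite -ler_pdivlMr// => kL; rewrite -natr1 /c [leRHS]mulrDl mul1r.
  apply: lerD => //; apply: le_trans kL _.
  rewrite mulrAC ler_wpM2r ?invr_ge0 ?(ltW lnr)//.
  by rewrite mulrDl mul1r lerD2l ler_peMr.
apply: (@le_trans _ _ (c * L * (C / L))); last first.
  by rewrite mulrACA divff ?mulr1// gt_eqF// (lt_le_trans ltr01).
apply: ler_pM => //; exact: gC.
Qed.

End dilation_balls.

(** * Discounted tails and the grand norm of sequences *)

Section discounted_tails.
Variables (R : realType) (t : R) (a : nat -> R).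
Hypotheses (t0 : 0 <= t) (t1 : t < 1) (a0 : forall l, 0 <= a l).

(** The tail of the series of [a] from [k] on, cut at [N] and discounted at
    rate [t]. *)
Definition tail (N k : nat) : R := \sum_(k <= l < N) t ^+ (l - k) * a l.

Let t1' : 0 < 1 - t. Proof. by rewrite subr_gt0. Qed.

Lemma tail_ge0 N k : 0 <= tail N k.
Proof. by apply: sumr_ge0 => l _; rewrite mulr_ge0 ?exprn_ge0. Qed.

Lemma tail_rec N k : (k < N)%N -> tail N k = a k + t * tail N k.+1.
Proof.
move=> kN; rewrite /tail big_ltn// subnn expr0 mul1r; congr (_ + _).
rewrite mulr_sumr; apply: eq_big_nat => l /andP[kl _].
by rewrite mulrA -exprS -subSn// subSS.
Qed.

Lemma nondecreasing_tail k : {homo tail^~ k : N N' / (N <= N')%N >-> N <= N'}.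
Proof.
apply: homo_leq => // [x y z|N]; first exact: le_trans.
have [kN|Nk] := leqP k N; last by rewrite /tail !big_geq ?(ltnW Nk).
by rewrite /tail big_nat_recr//= lerDl mulr_ge0 ?exprn_ge0.
Qed.

(** Young's inequality for the discounted tails, with the sharp constant.  The
    normalized tails [(1 - t) * tail N k] are convex combinations of [a k] and
    of the next normalized tail; convexity of the power and summation over
    [k] give [S <= (1 - t) * S' + t * S], where [S] is the sum on the left and
    [S'] the one on the right. *)
Lemma tail_young s N : 1 <= s ->
  \sum_(0 <= k < N) ((1 - t) * tail N k) `^ s <= \sum_(0 <= k < N) a k `^ s.
Proof.
move=> s1; pose y k := ((1 - t) * tail N k) `^ s.
have yrec k : (k < N)%N -> y k <= (1 - t) * a k `^ s + t * y k.+1.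
  move=> kN; rewrite /y tail_rec// mulrDr mulrCA.
  have := @powR_conv R s (1 - t) (a k) ((1 - t) * tail N k.+1) s1.
  rewrite subKr; apply => //.
  - by rewrite subr_ge0 ltW//= gerBl.
  - by rewrite mulr_ge0 ?tail_ge0// ltW.
have yN : y N = 0.
  by rewrite /y /tail big_geq// mulr0 powR0// gt_eqF// (lt_le_trans ltr01).
have shift : \sum_(0 <= k < N) y k.+1 <= \sum_(0 <= k < N) y k.
  have : \sum_(0 <= k < N.+1) y k = y 0%N + \sum_(0 <= k < N) y k.+1.
    by rewrite big_nat_recl.
  rewrite big_nat_recr//= yN addr0 => ->.
  by rewrite lerDr powR_ge0.
have : \sum_(0 <= k < N) y k <=
    (1 - t) * \sum_(0 <= k < N) a k `^ s + t * \sum_(0 <= k < N) y k.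
  apply: (@le_trans _ _
      (\sum_(0 <= k < N) ((1 - t) * a k `^ s + t * y k.+1))).
    by apply: ler_sum_nat => k /andP[_ kN]; exact: yrec.
  by rewrite big_split/= -!mulr_sumr lerD2l ler_wpM2l.
rewrite -lerBlDr -{1}[X in X - _]mul1r -mulrBl ler_pM2l//.
Qed.

Section limit.
Variables (s L : R).
Hypotheses (s1 : 1 <= s) (aL : forall N, \sum_(0 <= k < N) a k `^ s <= L).

Lemma is_cvg_tail k : cvgn (tail^~ k).
Proof.
have s0 : 0 < s := lt_le_trans ltr01 s1.
apply: nondecreasing_is_cvgn; first exact: nondecreasing_tail.
exists (L `^ s^-1 / (1 - t)) => _ [N _ <-].
have [kN|Nk] := ltnP k N; last first.
  by rewrite /tail big_geq// divr_ge0 ?powR_ge0// ltW.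
rewrite ler_pdivlMr// mulrC.
have y0 : 0 <= (1 - t) * tail N k by rewrite mulr_ge0 ?tail_ge0// ltW.
rewrite -(powRr1 y0) -[X in _ `^ X](divff (lt0r_neq0 s0)) powRrM.
have yL : ((1 - t) * tail N k) `^ s <= L.
  apply: le_trans (aL N); apply: le_trans (tail_young N s1).
  rewrite (bigD1_seq k) ?iota_uniq ?mem_index_iota//= lerDl.
  by apply: sumr_ge0 => j _; exact: powR_ge0.
have L0 := le_trans (powR_ge0 _ _) yL.
by apply: ge0_ler_powR; rewrite ?nnegrE ?powR_ge0 ?invr_ge0 ?(ltW s0).
Qed.

Lemma tail_le_lim N k : tail N k <= limn (tail^~ k).
Proof.
exact: (nondecreasing_cvgn_le (@nondecreasing_tail k) (@is_cvg_tail k)).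
Qed.

Lemma lim_tail_young K :
  \sum_(0 <= k < K) ((1 - t) * limn (tail^~ k)) `^ s <= L.
Proof.
have lim_sum : (fun N => \sum_(0 <= k < K) ((1 - t) * tail N k) `^ s) @ \oo -->
    \sum_(0 <= k < K) ((1 - t) * limn (tail^~ k)) `^ s.
  elim: K => [|K IH].
    rewrite big_geq//; under eq_fun do rewrite big_geq//.
    exact: cvg_cst.
  rewrite big_nat_recr//=; under eq_fun do rewrite big_nat_recr//=.
  apply: cvgD IH _; apply: cvg_powR => // [N|].
    by rewrite mulr_ge0 ?tail_ge0// ltW.
  by apply: cvgMr; exact: is_cvg_tail.
(* For [N >= K] the first [K] terms are part of the sum up to [N]. *)
apply: cvgr_to_le lim_sum _; exists K => // N /= KN.
apply: le_trans (aL N); apply: le_trans (tail_young N s1).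
rewrite [leRHS](big_cat_nat (n := K))//= lerDl.
by apply: sumr_ge0 => k _; exact: powR_ge0.
Qed.

End limit.

End discounted_tails.

Section grand_lnorm.
Variables (R : realType) (p theta : R).
Hypothesis p1 : 1 <= p.
Implicit Types (u v : nat -> \bar R).
Local Open Scope ereal_scope.

Let exponent_ge1 (eps : R) : (0 < eps -> 1 <= p * (1 + eps))%R.
Proof. by move=> e0; rewrite mulr_ege1// lerDl ltW. Qed.

(** A bound of the l^s norms that is uniform in [s >= 1] passes to the grand
    norm. *)
Lemma grand_lnorm_le u v (C : R) : (0 <= C)%R ->
  (forall s : R, (1 <= s)%R -> \sum_(0 <= k <oo) u k `^ s <=
     (C `^ s)%:E * \sum_(0 <= k <oo) v k `^ s) ->
  grand_lnorm p theta u <= C%:E * grand_lnorm p theta v.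
Proof.
move=> C0 uv; apply: ge_ereal_sup => _ [eps /= eps0 <-].
have s1 := exponent_ge1 eps0; set s := (p * (1 + eps))%R in s1 *.
have s0 : (0 < s)%R := lt_le_trans ltr01 s1.
have S0 w : 0 <= \sum_(0 <= k <oo) w k `^ s.
  by apply: nneseries_ge0 => k _ _; exact: poweR_ge0.
have e0 : 0 <= (eps `^ theta)%:E by rewrite lee_fin powR_ge0.
apply: (@le_trans _ _ (((C `^ s)%:E * ((eps `^ theta)%:E *
    \sum_(0 <= k <oo) v k `^ s)) `^ s^-1)).
  apply: gt0_ler_poweR; rewrite ?invr_ge0 ?(ltW s0)//.
  - by rewrite in_itv/= leey mule_ge0.
  - by rewrite in_itv/= leey !mule_ge0// lee_fin powR_ge0.
  - by rewrite muleCA lee_wpmul2l// uv.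
rewrite poweRM ?mule_ge0// ?lee_fin ?powR_ge0// poweR_EFin -powRrM.
rewrite divff ?gt_eqF// powRr1// lee_wpmul2l ?lee_fin//.
by apply: ereal_sup_ubound; exists eps.
Qed.

Lemma grand_lnorm_series_lty v (eps : R) : (0 < eps)%R ->
  grand_lnorm p theta v < +oo ->
  \sum_(0 <= k <oo) v k `^ (p * (1 + eps)) < +oo.
Proof.
move=> eps0 voo; have s1 := exponent_ge1 eps0.
set s := (p * (1 + eps))%R in s1 *.
have s0 : (0 < s)%R := lt_le_trans ltr01 s1.
have : ((eps `^ theta)%:E * \sum_(0 <= k <oo) v k `^ s) `^ s^-1 < +oo.
  by apply: le_lt_trans voo; apply: ereal_sup_ubound; exists eps.
move/lty_poweRy; rewrite invr_eq0 gt_eqF// => /(_ isT).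
rewrite !ltey; apply: contraNN => /eqP ->.
by rewrite gt0_muley// lte_fin powR_gt0.
Qed.

(** The exponent of [eps = 1] suffices. *)
Lemma grand_lnorm_term_lty v k :
  grand_lnorm p theta v < +oo -> v k < +oo.
Proof.
move=> /(grand_lnorm_series_lty ltr01) voo.
have s1 := exponent_ge1 ltr01.
have : v k `^ (p * (1 + 1)) < +oo.
  apply: le_lt_trans voo.
  rewrite (nneseries_split 0 k.+1)//; last by move=> ? _; exact: poweR_ge0.
  rewrite add0n big_nat_recr//= -addeA addeC -addeA leeDl//.
  apply: adde_ge0; last by apply: sume_ge0 => ? _; exact: poweR_ge0.
  by apply: nneseries_ge0 => ? _ _; exact: poweR_ge0.
by move/lty_poweRy; rewrite gt_eqF ?(lt_le_trans ltr01)//; apply.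
Qed.

End grand_lnorm.

Section grand_lnorm_comparison.
Variables (R : realType) (p theta : R).
Hypothesis p1 : 1 <= p.
Local Open Scope ereal_scope.

Lemma grand_lnorm_le_term (u v : nat -> \bar R) (C : R) : (0 <= C)%R ->
  (forall k, 0 <= u k) -> (forall k, 0 <= v k) ->
  (forall k, u k <= C%:E * v k) ->
  grand_lnorm p theta u <= C%:E * grand_lnorm p theta v.
Proof.
move=> C0 u0 v0 uv; apply: grand_lnorm_le => // s s1.
have s0 : (0 <= s)%R := le_trans ler01 s1.
rewrite -nneseriesZl; last by move=> k _; exact: poweR_ge0.
apply: lee_nneseries => k _; first by move=> _; exact: poweR_ge0.
rewrite -poweR_EFin -poweRM// ?lee_fin//; apply: gt0_ler_poweR => //.
- by rewrite in_itv/= u0 leey.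
- by rewrite in_itv/= mule_ge0 ?lee_fin// leey.
Qed.

Lemma grand_lnorm_tail (t : R) (a : nat -> R) : (0 <= t < 1)%R ->
  (forall k, 0 <= a k)%R ->
  grand_lnorm p theta (fun k => ((1 - t) * limn (tail t a ^~ k))%:E) <=
  grand_lnorm p theta (fun k => (a k)%:E).
Proof.
move=> /andP[t0 t1] a0; rewrite -[leRHS]mul1e; apply: grand_lnorm_le => // s s1.
rewrite powR1 mul1e.
have S0 : 0 <= \sum_(0 <= k <oo) (a k)%:E `^ s.
  by apply: nneseries_ge0 => k _ _; exact: poweR_ge0.
have [->|Soo] := eqVneq (\sum_(0 <= k <oo) (a k)%:E `^ s) +oo.
  exact: leey.
have /fineK <- : \sum_(0 <= k <oo) (a k)%:E `^ s \is a fin_num.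
  by rewrite ge0_fin_numE// ltey.
set L := fine _.
have aL N : (\sum_(0 <= k < N) a k `^ s <= L)%R.
  rewrite -lee_fin /L fineK ?ge0_fin_numE ?ltey// -sumEFin.
  under eq_bigr do rewrite -poweR_EFin.
  by apply: nneseries_lim_ge => k _ _; exact: poweR_ge0.
apply: lime_le.
  by apply: is_cvg_nneseries => k _ _; exact: poweR_ge0.
apply: nearW => K.
under eq_bigr do rewrite poweR_EFin.
by rewrite sumEFin lee_fin; exact: lim_tail_young.
Qed.

End grand_lnorm_comparison.

(** * Cubes and compact sets *)

Section local_integrability.
Variables (R : realType) (n : nat).

(** The closed cube of half-side [m] centred at the origin. *)
Definition cube (m : nat) : set (Rn R n) := [set x | forall i, `|x i 0| <= m%:R].

(** Transpose of a compact set of row vectors. *)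
Lemma compact_cube m : compact (cube m : set 'cV[R]_n.+1).
Proof.
have -> : cube m = (@trmx R 1 n.+1) @`
    [set v : 'rV[R]_n.+1 | forall i, `[- m%:R, m%:R]%classic (v ord0 i)].
  apply/seteqP; split => [x xm|_ [v vm <-] i].
    exists x^T; rewrite ?trmxK// => i /=; rewrite mxE in_itv/= -ler_norml.
    exact: xm.
  by rewrite mxE ler_norml; have := vm i; rewrite /= in_itv.
apply: continuous_compact; last first.
  have := @rV_compact R n.+1 (fun=> `[- m%:R, m%:R]%classic).
  by apply => i; exact: segment_compact.
apply: continuous_subspaceT => v B /nbhs_ballP[e e0 eB].
apply/nbhs_ballP; exists e => // w [_ vw]; apply: eB; split => // i j.
by rewrite !mxE; exact: vw.
Qed.

Lemma measurable_cube m : measurable (cube m).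
Proof.
have -> : cube m = \bigcap_(i in [set: 'I_n.+1])
    ((fun x : Rn R n => x i 0) @^-1` `[- m%:R, m%:R]%classic).
  apply/seteqP; split => x xm.
    by move=> i _ /=; rewrite in_itv/= -ler_norml; exact: xm.
  by move=> i; have := xm i I; rewrite /= in_itv/= -ler_norml.
apply: fin_bigcap_measurable => // i _; rewrite -[X in measurable X]setTI.
exact: (measurable_coord i measurableT (measurable_itv _)).
Qed.

(** Measurability on each compact set is enough, as the cubes are compact,
    measurable and exhaust the space. *)
Lemma vLebesgue_loc_measurable (q f : Rn R n -> R) :
  vLebesgue_loc setT q f -> measurable_fun setT f.
Proof.
move=> fq; have <- : \bigcup_m cube m = setT.
  apply/seteqP; split => // x _; exists (Num.truncn (\sum_i `|x i 0|)).+1 => //.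
  move=> i; apply: le_trans (ltW (truncnS_gt _)).
  by rewrite (bigD1 i)//= lerDl sumr_ge0.
apply/measurable_fun_bigcup; first exact: measurable_cube.
by move=> m; have /set_mem[] := fq _ (@compact_cube m) (@subsetT _ _).
Qed.

Lemma compact_enorm_le (E : set 'cV[R]_n.+1) : compact E ->
  exists c : R, E `<=` [set x | enorm x <= c].
Proof.
move=> /compact_bounded[M [_ EM]]; exists (\sum_(i < n.+1) (M + 1)) => x Ex /=.
apply: le_trans (ler_enorm_sum _) _.
apply: ler_sum => i _.
apply: le_trans (EM (M + 1) _ x Ex); last by rewrite ltrDl.
rewrite [leRHS]/Num.norm /= mx_normrE; apply/bigmax_geP; right.
by exists (i, 0).
Qed.

End local_integrability.

(** * Block decompositions *)

Section block_decomposition.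
Variables (R : realType) (n : nat) (A P : 'M[R]_n.+1) (r p theta : R).
Variables (q alpha : Rn R n -> R) (alpha_infty : R).
Hypotheses (dilA : is_dilation A) (adP : adapted_ellipsoid A P r).
Hypotheses (p1 : 1 <= p) (mq : measurable_fun setT q).
Hypotheses (q1 : forall x, 1 <= q x) (malpha : measurable_fun setT alpha).
Hypothesis alphaP : log_holder_infty alpha alpha_infty.
Local Notation mu := (@lebesgue_Rn R n).
Local Notation b := (dil_det A).
Local Notation shell k := (dil_ring A P k).
Implicit Types (f g : Rn R n -> R).

Let b_gt0 : 0 < b.
Proof. exact: lt_trans ltr01 (dil_det_gt1 dilA). Qed.

Let vnormE D f : vnorm D q f = luxemburg mu D q f. Proof. by []. Qed.

(** The restriction of [f] to the [k]-th ring, without weight. *)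
Definition ring_part f (k : nat) : Rn R n -> R := fun x => f x * \1_(shell k) x.

Lemma measurable_ring_part f k : measurable_fun setT f ->
  measurable_fun setT (ring_part f k).
Proof.
by move=> mf; apply: measurable_mul_indic => //; exact: measurable_dil_ring.
Qed.

Lemma measurable_herz_piece f k : measurable_fun setT f ->
  measurable_fun setT (herz_piece A P alpha f k).
Proof.
by move=> mf; apply: measurable_weighted => //; exact: measurable_dil_ring.
Qed.

Lemma series_ring_part f x : series (fun k => ring_part f k x) @ \oo --> f x.
Proof.
have [k0 xk0] := dil_ring_indicE adP x.
apply: cvg_near_cst; exists k0.+1 => // N /= k0N.
rewrite seriesEnat/= (bigD1_seq k0) ?mem_index_iota ?iota_uniq//=.
rewrite /ring_part xk0 eqxx mulr1 big1 ?addr0// => k /negPf kk0.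
by rewrite xk0 kk0 mulr0.
Qed.

(** On the [k]-th ring the weights [b^(k alpha)] and [b^(k alpha_infty)] are
    comparable, uniformly in [k]. *)
Lemma ring_weights : exists2 M : R, 0 < M & forall k x, shell k x ->
  b `^ (k%:R * alpha x) <= M * b `^ (k%:R * alpha_infty) /\
  b `^ (k%:R * alpha_infty) <= M * b `^ (k%:R * alpha x).
Proof.
have [c c0 kc] := log_holder_infty_ring adP alphaP.
exists (b `^ c); first exact: powR_gt0.
have b1 := ltW (dil_det_gt1 dilA).
move=> k x /kc; rewrite -[k%:R in X in X -> _]ger0_norm// -normrM ler_norml.
rewrite mulrBr => /andP[c1 c2].
by rewrite -!powRD ?(gt_eqF b_gt0) ?implybT//; split; apply: ler_powR => //; lra.
Qed.

(** Up to a constant independent of [k], the weight [b^(k alpha)] of a Herz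
    piece may be replaced by the number [b^(k alpha_infty)]. *)
Lemma ring_norms : exists2 M : R, 0 < M & forall f k,
  (vnorm setT q (herz_piece A P alpha f k) <=
    (M * b `^ (k%:R * alpha_infty))%:E * vnorm setT q (ring_part f k))%E /\
  (vnorm setT q (ring_part f k) <=
    (M * b `^ (- (k%:R * alpha_infty)))%:E *
      vnorm setT q (herz_piece A P alpha f k))%E.
Proof.
have [M M0 wM] := ring_weights; exists M => // f k; rewrite !vnormE.
have pieceE x : `|herz_piece A P alpha f k x| =
    b `^ (k%:R * alpha x) * `|ring_part f k x|.
  by rewrite /herz_piece -mulrA normrM ger0_norm ?powR_ge0.
have part0 x : ~ shell k x -> `|ring_part f k x| = 0.
  by move=> xk; rewrite /ring_part indicE memNset// mulr0 normr0.
split; apply: luxemburg_mono => //; rewrite ?mulr_ge0 ?powR_ge0 ?(ltW M0)//.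
- move=> x; rewrite pieceE.
  have [/wM[xM _]|/part0 ->] := pselect (shell k x); last by rewrite !mulr0.
  by rewrite ler_wpM2r.
- move=> x; rewrite pieceE.
  have [/wM[_ xM]|/part0 ->] := pselect (shell k x); last by rewrite !mulr0.
  rewrite mulrA ler_peMl// powRN mulrAC ler_pdivlMr ?powR_gt0//.
  by rewrite mul1r.
Qed.

(** The coefficients are [b^(k alpha_infty)] times the norms of the ring
    restrictions, and the blocks are the normalized ring restrictions.  A ring
    restriction of norm 0 vanishes almost everywhere and is replaced by 0, which
    is why the series represents [f] only almost everywhere. *)
Lemma grand_herz_blocks f : grand_herz A P alpha q p theta f ->
  exists (lambda : nat -> R) (a : nat -> Rn R n -> R),
    [/\ forall k, central_block A P q alpha_infty k (a k),
        {ae mu, forall x, series (fun k => lambda k * a k x) @ \oo --> f x}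
      & (grand_lnorm p theta (fun k => `|lambda k|%:E) < +oo)%E].
Proof.
move=> [/set_mem /vLebesgue_loc_measurable mf foo].
have [M M0 normM] := ring_norms.
pose u k := vnorm setT q (herz_piece A P alpha f k).
have u0 k : (0 <= u k)%E by rewrite /u vnormE luxemburg_ge0.
have uoo k : (u k < +oo)%E := grand_lnorm_term_lty p1 k foo.
pose N k := fine (vnorm setT q (ring_part f k)).
have NE k : vnorm setT q (ring_part f k) = (N k)%:E.
  rewrite fineK// ge0_fin_numE; last by rewrite vnormE luxemburg_ge0.
  apply: le_lt_trans (normM f k).2 _.
  apply: lte_mul_pinfty => //; last exact: uoo.
  by rewrite lee_fin mulr_ge0 ?powR_ge0// ltW.
have N0 k : 0 <= N k by rewrite -lee_fin -NE vnormE luxemburg_ge0.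
pose lam k := b `^ (k%:R * alpha_infty) * N k.
have lam0 k : 0 <= lam k by rewrite mulr_ge0 ?powR_ge0.
(* When [N k = 0] the inverse of [lam k] is 0, so that [a k] vanishes. *)
pose a k x := (lam k)^-1 * ring_part f k x.
exists lam, a; split.
- move=> k; split.
  + have := measurable_ring_part k mf.
    exact: (measurableT_comp (mulrl_measurable (D := setT) (lam k)^-1)).
  + move=> x /=; rewrite /a /ring_part indicE.
    case: (boolP (x \in _)) => [/set_mem/sub_dil_ring_ball//|_].
    by rewrite !mulr0 eqxx.
  + rewrite vnormE; have lamV0 : 0 <= (lam k)^-1 by rewrite invr_ge0.
    have : (luxemburg mu setT q (a k) <=
        (lam k)^-1%:E * luxemburg mu setT q (ring_part f k))%E.
      by apply: luxemburg_mono => // x; rewrite /a normrM ger0_norm.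
    move=> /le_trans; apply; rewrite -vnormE NE -EFinM lee_fin /lam powRN.
    have [->|Nk0] := eqVneq (N k) 0; first by rewrite mulr0 invr_ge0 powR_ge0.
    by rewrite invfM divfK.
- have : \forall x \ae mu, forall k, lam k * a k x = ring_part f k x.
    apply/ae_foralln => k; have [Nk0|Nk0] := eqVneq (N k) 0.
      have := NE k; rewrite Nk0 vnormE.
      move=> /(luxemburg_eq0 mq q1 (measurable_ring_part k mf)).
      by apply: filterS => x fx; rewrite /a fx !mulr0.
    apply: nearW => x; rewrite /a mulVKf// /lam mulf_neq0// gt_eqF//.
    exact: powR_gt0.
  apply: filterS => x xk.
  rewrite (_ : (fun k => _) = fun k => ring_part f k x); last exact/funext.
  exact: series_ring_part.
- apply: (@le_lt_trans _ _ (M%:E * grand_lnorm p theta u)%E).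
    apply: grand_lnorm_le_term => //; first exact: ltW.
    move=> k; rewrite ger0_norm// /lam EFinM -NE.
    have bk : 0 <= b `^ (k%:R * alpha_infty) := powR_ge0 _ _.
    apply: le_trans (lee_wpmul2l _ (normM f k).2) _; rewrite ?lee_fin//.
    rewrite muleA -EFinM mulrCA powRN divff ?mulr1// gt_eqF//.
    exact: powR_gt0.
  by apply: lte_mul_pinfty => //; rewrite lee_fin ltW.
Qed.

Section from_blocks.
Variables (lambda : nat -> R) (a : nat -> Rn R n -> R) (f : Rn R n -> R).
Hypothesis alpha_infty0 : 0 < alpha_infty.
Hypothesis blocks : forall k, central_block A P q alpha_infty k (a k).
Hypothesis fE :
  {ae mu, forall x, series (fun k => lambda k * a k x) @ \oo --> f x}.
Hypothesis lamoo : (grand_lnorm p theta (fun k => `|lambda k|%:E) < +oo)%E.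

Let t := b `^ (- alpha_infty).

Let t0 : 0 <= t. Proof. exact: powR_ge0. Qed.

Let t1 : t < 1.
Proof.
rewrite /t powRN invf_lt1 ?powR_gt0// /powR gt_eqF// expR_gt1.
by rewrite mulr_gt0// ln_gt0// dil_det_gt1.
Qed.

Let F N : Rn R n -> R := fun x => \sum_(0 <= l < N) lambda l * a l x.

Let mterm l : measurable_fun setT (fun x => lambda l * a l x).
Proof.
have [mal _ _] := blocks l.
exact: (measurableT_comp (mulrl_measurable (D := setT) (lambda l)) mal).
Qed.

Let mF N : measurable_fun setT (F N).
Proof. by apply: measurable_sum => l; exact: mterm. Qed.

Let mf : measurable_fun setT f.
Proof.
by apply: (measurable_fun_ae_cvg (@lebesgue_Rn_complete R n) mF); exact: fE.
Qed.

(** Blocks with index below [k] vanish on the [k]-th ring; those with index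
    [l >= k] contribute [b^(k alpha_infty) * |lambda l| * b^(-l alpha_infty)],
    up to a constant. *)
Lemma herz_piece_partial_sum : exists2 M : R, 0 < M & forall N k,
  (vnorm setT q (herz_piece A P alpha (F N) k) <=
    (M * tail t (fun l => `|lambda l|) N k)%:E)%E.
Proof.
have [M M0 normM] := ring_norms; exists M => // N k.
pose G l := herz_piece A P alpha (fun x => lambda l * a l x) k.
have -> : herz_piece A P alpha (F N) k =
    fun x => \sum_(0 <= l < N) G l x.
  apply/funext => x; rewrite /herz_piece /F mulrAC mulr_sumr.
  by apply: eq_bigr => l _; rewrite /G /herz_piece mulrAC.
have mG l : measurable_fun setT (G l) by exact: measurable_herz_piece.
rewrite vnormE.
apply: le_trans (luxemburg_sum mu mq q1 (index_iota 0 N) mG) _.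
have G0 l : (l < k)%N -> G l = fun=> 0.
  move=> lk; apply/funext => x; rewrite /G /herz_piece indicE.
  case: (boolP (x \in _)) => [/set_mem xk|_]; last by rewrite mulr0.
  have [_ al _] := blocks l; have [->|/al xl] := eqVneq (a l x) 0.
    by rewrite !mulr0 mul0r.
  by move: lk; rewrite ltnNge (dil_ring_ball_disj adP xk xl).
have Gl l : (k <= l)%N ->
    (luxemburg mu setT q (G l) <= (M * (t ^+ (l - k) * `|lambda l|))%:E)%E.
  move=> kl; have [_ _ al] := blocks l.
  apply: le_trans (normM _ _).1 _; rewrite vnormE.
  have bk : 0 <= b `^ (k%:R * alpha_infty) := powR_ge0 _ _.
  have rp x : `|ring_part (fun x => lambda l * a l x) k x| <=
      `|lambda l| * `|a l x|.
    rewrite /ring_part normrM normrM ler_piMr// ?mulr_ge0//.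
    by rewrite indicE; case: (_ \in _); rewrite ?normr1 ?normr0.
  apply: (@le_trans _ _ ((M * b `^ (k%:R * alpha_infty))%:E *
      (`|lambda l|%:E * (b `^ (- (l%:R * alpha_infty)))%:E))%E).
    apply: lee_wpmul2l; first by rewrite lee_fin mulr_ge0// ltW.
    have := luxemburg_mono mu q1 (normr_ge0 (lambda l)) rp.
    by move=> /le_trans; apply; apply: lee_wpmul2l => //; rewrite lee_fin.
  rewrite -!EFinM lee_fin -mulrA ler_pM2l// mulrCA [leRHS]mulrC ler_wpM2l//.
  rewrite -powRD ?(gt_eqF b_gt0) ?implybT// /t -powR_mulrn ?powR_ge0// -powRrM.
  by rewrite natrB// le_eqVlt; apply/orP; left; apply/eqP; congr (_ `^ _); ring.
apply: (@le_trans _ _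
    (\sum_(k <= l < N) (M * (t ^+ (l - k) * `|lambda l|))%:E)%E).
  have [Nk|kN] := leqP N k.
    rewrite [leRHS]big_geq// big_nat big1// => l /andP[_ lN].
    by rewrite G0 ?luxemburg0// (leq_trans lN).
  rewrite (big_cat_nat (n := k)) ?(ltnW kN)//= big_nat big1 ?add0e; last first.
    by move=> l /andP[_ lk]; rewrite G0// luxemburg0.
  rewrite big_nat [leRHS]big_nat; apply: lee_sum => l /andP[kl _].
  exact: Gl.
by rewrite sumEFin -mulr_sumr.
Qed.

(** The bound on partial sums passes to [f] by the Fatou property, and Young's
    inequality bounds the grand norm of the resulting sequence. *)
Lemma blocks_grand_herz : grand_herz A P alpha q p theta f.
Proof.
have t01 : 0 <= t < 1 by rewrite t0 t1.
have [M M0 FM] := herz_piece_partial_sum.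
have [M' M'0 normM'] := ring_norms.
pose c k := limn (tail t (fun l => `|lambda l|) ^~ k).
(* The exponent of [eps = 1], for which the series of [|lambda k|^s0] converges;
   this makes the discounted tails converge. *)
pose s0 := p * (1 + 1).
have s01 : 1 <= s0 by rewrite mulr_ege1// lerDl.
pose L := fine (\sum_(0 <= k <oo) `|lambda k|%:E `^ s0)%E.
have lamL N : \sum_(0 <= k < N) `|lambda k| `^ s0 <= L.
  have lam_ge0 k : (0%N <= k)%N -> true -> (0 <= `|lambda k|%:E `^ s0)%E.
    by move=> _ _; exact: poweR_ge0.
  rewrite -lee_fin /L fineK.
    rewrite -sumEFin; under eq_bigr do rewrite -poweR_EFin.
    exact: nneseries_lim_ge.
  rewrite ge0_fin_numE; last exact: nneseries_ge0.
  exact: (grand_lnorm_series_lty p1 ltr01 lamoo).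
have tail_c N k : tail t (fun l => `|lambda l|) N k <= c k.
  by apply: (tail_le_lim t0 t1 _ s01 lamL).
have c0 k : 0 <= c k by apply: le_trans (tail_c 0%N k); exact: tail_ge0.
have uc k : (vnorm setT q (herz_piece A P alpha f k) <= (M * c k)%:E)%E.
  rewrite vnormE; apply: (@luxemburg_fatou _ _ _ mu q mq q1
      (fun N => herz_piece A P alpha (F N) k)).
  - by move=> N; exact: measurable_herz_piece.
  - exact: measurable_herz_piece.
  - apply: filterS fE => x Fx.
    by apply: cvgMl; apply: cvgMr; exact: Fx.
  - move=> N; apply: le_trans (FM N k) _.
    by rewrite lee_fin ler_wpM2l// ltW.
have normoo : (herz_norm A P alpha q p theta f < +oo)%E.
  have Mt : 0 <= M / (1 - t) by rewrite divr_ge0 ?subr_ge0// ltW.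
  apply: (@le_lt_trans _ _ ((M / (1 - t))%:E *
      grand_lnorm p theta (fun k => `|lambda k|%:E))%E).
    apply: (@le_trans _ _ ((M / (1 - t))%:E *
        grand_lnorm p theta (fun k => ((1 - t) * c k)%:E))%E).
      apply: grand_lnorm_le_term => //.
      - by move=> k; rewrite vnormE luxemburg_ge0.
      - by move=> k; rewrite lee_fin mulr_ge0// subr_ge0 ltW.
      - move=> k; apply: le_trans (uc k) _; rewrite -EFinM lee_fin.
        by rewrite mulrA divfK// subr_eq0 gt_eqF.
    apply: lee_wpmul2l; first by rewrite lee_fin.
    exact: grand_lnorm_tail.
  by apply: lte_mul_pinfty => //; rewrite lee_fin.
(* Local integrability: a compact set lies in some ball [B_K], on which [f] is a
   finite sum of ring restrictions. *)
split => //; apply: mem_set => E cE _; apply: mem_set; split.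
  exact: measurable_funTS.
have [e Ee] := compact_enorm_le cE.
have [K eK] := enorm_le_sub_dil_ball adP e.
pose g x := \sum_(0 <= k < K.+1) ring_part f k x.
apply: (@le_lt_trans _ _ (vnorm setT q g)).
  rewrite !vnormE; apply: luxemburg_sub_domain => x /Ee/eK xK.
  have [k0 xk0] := dil_ring_indicE adP x.
  have k0K : (k0 <= K)%N.
    apply: (dil_ring_ball_disj adP _ xK); apply: contrapT => xk.
    have := xk0 k0; rewrite eqxx indicE memNset// => /eqP.
    by rewrite eq_sym oner_eq0.
  rewrite /g (bigD1_seq k0) ?mem_index_iota ?iota_uniq//=.
  rewrite /ring_part xk0 eqxx mulr1 big1 ?addr0// => k /negPf kk0.
  by rewrite xk0 kk0 mulr0.
have mpart k : measurable_fun setT (ring_part f k).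
  exact: measurable_ring_part.
rewrite vnormE.
apply: le_lt_trans (luxemburg_sum mu mq q1 (index_iota 0 K.+1) mpart) _.
apply: lte_sum_pinfty => k _; apply: le_lt_trans (normM' f k).2 _.
apply: lte_mul_pinfty => //; last exact: grand_lnorm_term_lty normoo.
by rewrite lee_fin mulr_ge0 ?powR_ge0// ltW.
Qed.

End from_blocks.

End block_decomposition.

Theorem theorem3p2 (R : realType) (n : nat) (A P : 'M[R]_n.+1) (r p theta : R)
    (q alpha : Rn R n -> R) (alpha_infty : R) (f : Rn R n -> R) :
  is_dilation A -> adapted_ellipsoid A P r ->
  1 <= p -> 0 < theta -> variable_exponent q ->
  alpha \in Lfun (@lebesgue_Rn R n) +oo%E ->
  log_holder_origin alpha -> log_holder_infty alpha alpha_infty ->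
  0 < alpha_infty ->
  (f \in grand_herz A P alpha q p theta <->
   exists (lambda : nat -> R) (a : nat -> Rn R n -> R),
    [/\ forall k, central_block A P q alpha_infty k (a k),
        {ae @lebesgue_Rn R n, forall x,
          series (fun k => lambda k * a k x) @ \oo --> f x}
      & (grand_lnorm p theta (fun k => `|lambda k|%:E) < +oo)%E]).
Proof.
move=> dilA adP p1 _ [mq q1 _ _] alphaL _ alphaP alpha_infty0.
have malpha : measurable_fun setT alpha by exact: set_mem (sub_Lfun_mfun alphaL).
split => [/set_mem fK|[lambda [a [blocks fE lamoo]]]].
  exact: (grand_herz_blocks dilA adP p1 mq q1 alphaP fK).
by apply: mem_set; exact: (blocks_grand_herz dilA adP p1 mq q1 malpha alphaP
  alpha_infty0 blocks fE lamoo).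
Qed.
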